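(* Let $\mathbb{P}$ be a ground logic program with associated coalgebra $p:At\to\mathcal{P}_f\mathcal{L}(At)$. Given lists $l_1,\dots,l_k\in\mathcal{L}At$ of atoms in $At$, $$[\![l_1::\dots::l_k]\!]_{p_\lambda}=[\![l_1]\!]_{p_\lambda}\,\overline{::}\,\dots\,\overline{::}\,[\![l_k]\!]_{p_\lambda},$$ where $l_1::\dots::l_k$ denotes $\mu^{\mathcal{L}}_{At}([l_1,\dots,l_k])$ (list concatenation) and $[\![l_1]\!]_{p_\lambda}\overline{::}\dots\overline{::}[\![l_k]\!]_{p_\lambda}$ denotes $\overline{::}\,([[\![l_1]\!]_{p_\lambda},\dots,[\![l_k]\!]_{p_\lambda}])$.
   Context: $At$ is the set of ground (variable-free) atoms over a fixed alphabet; a ground logic program $\mathbb{P}$ is a finite set of clauses $H\leftarrow B_1,\dots,B_k$ ($k\geq0$) with $H,B_i\in At$. $\mathcal{P}_f$ is the finite powerset functor on $\mathbf{Set}$ and $\mathcal{L}$ the list monad on $\mathbf{Set}$ with unit $\eta^{\mathcal{L}}(x)=[x]$ and multiplication $\mu^{\mathcal{L}}$ given by flattening, also written $::$. The coalgebra of $\mathbb{P}$ is $p:At\to\mathcal{P}_f\mathcal{L}(At)$, $p(A)=\{[B_1,\dots,B_k]\mid(A\leftarrow B_1,\dots,B_k)\in\mathbb{P}\}$. $\lambda:\mathcal{L}\mathcal{P}_f\Rightarrow\mathcal{P}_f\mathcal{L}$ is the distributive law $\lambda_X([X_1,\dots,X_k])=\{[x_1,\dots,x_k]\mid x_i\in X_i\}$.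 Define $p_\lambda=\mathcal{P}_f(\mu^{\mathcal{L}}_{At})\circ\lambda_{\mathcal{L}At}\circ\mathcal{L}p:\mathcal{L}At\to\mathcal{P}_f\mathcal{L}At$, i.e. $p_\lambda([A_1,\dots,A_k])=\{m_1::\dots::m_k\mid m_i\in p(A_i)\}$. Let $c:\Omega\to\mathcal{L}At\times\mathcal{P}_f(\Omega)$ be the final $\mathcal{L}At\times\mathcal{P}_f(\cdot)$-coalgebra in $\mathbf{Set}$ ($\Omega=\mathcal{C}(\mathcal{P}_f)(\mathcal{L}At)$). Let $\lambda'_X=(\mu^{\mathcal{L}}_{At}\times\lambda_X)\circ\langle\mathcal{L}\pi_1,\mathcal{L}\pi_2\rangle:\mathcal{L}(\mathcal{L}At\times\mathcal{P}_fX)\to\mathcal{L}At\times\mathcal{P}_f\mathcal{L}X$. The map $\overline{::}:\mathcal{L}(\Omega)\to\Omega$ is the unique $\mathcal{L}At\times\mathcal{P}_f(\cdot)$-coalgebra morphism from $(\mathcal{L}\Omega,\lambda'_\Omega\circ\mathcal{L}c)$ to $(\Omega,c)$. The semantics $[\![\cdot]\!]_{p_\lambda}:\mathcal{L}At\to\Omega$ is the unique $\mathcal{L}At\times\mathcal{P}_f(\cdot)$-coalgebra morphism from $(\mathcal{L}At,\langle id,p_\lambda\rangle)$ to $(\Omega,c)$ (it is the morphism underlying the unique morphism to the final $\lambda'$-bialgebra $(\Omega,\overline{::},c)$). *)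

(* Defs.v *)
From Stdlib Require Import List.
From mathcomp Require Import all_boot.
From mathcomp Require Import boolp classical_sets functions cardinality.

Set Implicit Arguments.
Unset Strict Implicit.
Unset Printing Implicit Defensive.

Local Open Scope classical_set_scope.

(* Variables are left out of the alphabet: they do not occur in ground
   terms and ground atoms. *)
Record alphabet : Type := Alphabet {
  fun_sym : Type;
  fun_arity : fun_sym -> nat;
  pred_sym : Type;
  pred_arity : pred_sym -> nat }.

Inductive ground_term (S : alphabet) : Type :=
  GTerm (f : fun_sym S) (ts : {ffun 'I_(fun_arity f) -> ground_term S}).

Inductive ground_atom (S : alphabet) : Type :=
  GAtom (q : pred_sym S) (ts : {ffun 'I_(pred_arity q) -> ground_term S}).

(* The finite powerset functor on Set; sets are arbitrary types, and two
   elements of [Pf X] with the same members are equal ([Pf_ext]). *)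
Record Pf (X : Type) : Type := MkPf {
  Pf_set : set X;
  Pf_finite : finite_set Pf_set }.

Lemma Pf_ext (X : Type) (U V : Pf X) : Pf_set U = Pf_set V -> U = V.
Proof.
by case: U V => [U fU] [V fV] /= eUV; subst V; congr MkPf; apply: Prop_irrelevance.
Qed.

Definition Pf_map (X Y : Type) (h : X -> Y) (U : Pf X) : Pf Y :=
  MkPf (finite_image h (Pf_finite U)).

(* [Forall2] forces the members of [lambda Us] to have the length of [Us]. *)
Definition lambda_set (X : Type) (Us : seq (Pf X)) : set (seq X) :=
  [set xs | Forall2 (fun x U => Pf_set U x) xs Us].

Lemma lambda_finite (X : Type) (Us : seq (Pf X)) : finite_set (lambda_set Us).
Proof.
elim: Us => [|U Us IH].
  apply: (@sub_finite_set _ _ [set [::]]); last exact: finite_set1.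
  by move=> xs /= H; inversion H.
apply: (@sub_finite_set _ _
  ((fun z : X * seq X => z.1 :: z.2) @` (Pf_set U `*` lambda_set Us))).
  by move=> xs /= H; inversion H as [|x U' xs' Us' Ux Hxs]; subst; exists (x, xs').
exact: finite_image (finite_setX (Pf_finite U) IH).
Qed.

Definition lambda (X : Type) (Us : seq (Pf X)) : Pf (seq X) :=
  MkPf (@lambda_finite X Us).

Record clause (At : Type) : Type := Clause { head : At; body : seq At }.

Definition ground_program (S : alphabet) : Type := Pf (clause (ground_atom S)).

Section Coalgebras.
Variable At : Type.

Definition bodies (P : Pf (clause At)) (A : At) : set (seq At) :=
  [set Bs | Pf_set P (Clause A Bs)].

Lemma bodies_finite (P : Pf (clause At)) (A : At) : finite_set (bodies P A).
Proof.
apply: sub_finite_set (finite_image (@body At) (Pf_finite P)).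
by move=> Bs /= PBs; exists (Clause A Bs).
Qed.

Definition program_coalg (P : Pf (clause At)) (A : At) : Pf (seq At) :=
  MkPf (@bodies_finite P A).

(* The multiplication of the list monad is [flatten]. *)
Definition p_lambda (p : At -> Pf (seq At)) (l : seq At) : Pf (seq At) :=
  Pf_map flatten (lambda (map p l)).

Definition B (X : Type) : Type := (seq At * Pf X)%type.

Definition B_map (X Y : Type) (h : X -> Y) (b : B X) : B Y :=
  (b.1, Pf_map h b.2).

Definition is_coalg_morphism (X Y : Type) (d : X -> B X) (e : Y -> B Y)
    (h : X -> Y) : Prop :=
  forall x, e (h x) = B_map h (d x).

Definition is_final (Omega : Type) (c : Omega -> B Omega) : Prop :=
  forall (X : Type) (d : X -> B X), exists! h : X -> Omega,
    is_coalg_morphism d c h.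

Definition lambda' (X : Type) (bs : seq (B X)) : B (seq X) :=
  (flatten (map fst bs), lambda (map snd bs)).

Section Final.
Variables (Omega : Type) (c : Omega -> B Omega) (c_final : is_final c).

Definition ana (X : Type) (d : X -> B X) : X -> Omega :=
  sval (cid (c_final d)).

Lemma ana_morphism (X : Type) (d : X -> B X) : is_coalg_morphism d c (ana d).
Proof. by rewrite /ana; case: cid => h []. Qed.

Lemma ana_unique (X : Type) (d : X -> B X) (h : X -> Omega) :
  is_coalg_morphism d c h -> h = ana d.
Proof. by rewrite /ana; case: cid => k [_ /= uk] /uk. Qed.

(* The operation on Omega written as an overlined [::]. *)
Definition ocat : seq Omega -> Omega := ana (fun ws => lambda' (map c ws)).

Definition semantics (p : At -> Pf (seq At)) : seq At -> Omega :=
  ana (fun l => (l, p_lambda p l)).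

End Final.

End Coalgebras.

(* Main.v *)
(** Both sides of the equation, as functions of the list of lists [ls], are
    coalgebra morphisms into the final coalgebra from [seq (seq At)] with the
    structure [lambda'] after [map <id, p_lambda p>], so they agree. For the
    right-hand side this is the naturality of [lambda']; for the left-hand side
    it is the compatibility of [lambda] with the list multiplication, which
    makes [flatten] a morphism to the coalgebra [<id, p_lambda p>]. *)
Require Import Defs.
From Stdlib Require List.
From mathcomp Require Import all_boot.
From mathcomp Require Import boolp classical_sets.

Lemma flatten_flatten (T : Type) (sss : seq (seq (seq T))) :
  flatten (flatten sss) = flatten (map flatten sss).
Proof. by elim: sss => //= ss sss IH; rewrite flatten_cat IH. Qed.

Lemma Pf_map_comp (X Y Z : Type) (g : Y -> Z) (h : X -> Y) (U : Pf X) :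
  Pf_map g (Pf_map h U) = Pf_map (g \o h) U.
Proof. exact/Pf_ext/image_comp. Qed.

(** Each entry of a list chosen from the images has a preimage in its set; gathered by induction,
    these form a choice from [Us]. *)
Lemma lambda_natural (X Y : Type) (h : X -> Y) (Us : seq (Pf X)) :
  lambda (map (Pf_map h) Us) = Pf_map (map h) (lambda Us).
Proof.
apply/Pf_ext/seteqP; split=> [ys | _ [xs H <-]] /=; last first.
  by elim: H => [|x U {}xs {}Us Ux _ IH]; constructor => //; exists x.
elim: Us ys => [|U Us IH] ys H; inversion H as [|y V ys' Vs Vy Hys]; subst.
  by exists [::]; first constructor.
have [x Ux <-] := Vy; have [xs Hxs <-] := IH _ Hys.
by exists (x :: xs); first constructor.
Qed.

(** A choice from a concatenation can be cut into one choice per block; conversely, choices from the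
    blocks concatenate. *)
Lemma lambda_flatten (X : Type) (Uss : seq (seq (Pf X))) :
  lambda (flatten Uss) = Pf_map flatten (lambda (map (@lambda X) Uss)).
Proof.
apply/Pf_ext/seteqP; split=> [xs | _ [xss H <-]] /=.
  elim: Uss xs => [|Us Uss IH] xs H.
    by inversion H; exists [::]; first constructor.
  have [xs1 [xs2 [H1 [H2 ->]]]] := List.Forall2_app_inv_r _ _ H.
  have [xss Hxss <-] := IH _ H2.
  by exists (xs1 :: xss); first constructor.
elim: Uss xss H => [|Us Uss IH] xss H.
  by inversion H; constructor.
inversion H as [|xs V xss' Vs Vxs Hxss]; subst.
by apply: List.Forall2_app => //; apply: IH.
Qed.

Lemma lambda'_natural (At X Y : Type) (h : X -> Y) (bs : seq (B At X)) :
  lambda' (map (B_map h) bs) = B_map (map h) (lambda' bs).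
Proof.
by rewrite /lambda' /B_map /= -lambda_natural -!map_comp.
Qed.

Lemma p_lambda_flatten (At : Type) (p : At -> Pf (seq At))
    (ls : seq (seq At)) :
  p_lambda p (flatten ls) = Pf_map flatten (lambda (map (p_lambda p) ls)).
Proof.
have -> : map (p_lambda p) ls =
    map (Pf_map flatten) (map (@lambda _) (map (map p) ls)).
  by rewrite -!map_comp.
(* Both sides become images of one set, under [flatten \o flatten] and [flatten \o map flatten],
   which agree by associativity. *)
rewrite lambda_natural Pf_map_comp /p_lambda map_flatten lambda_flatten.
by rewrite Pf_map_comp; congr Pf_map; apply/funext => ?; apply: flatten_flatten.
Qed.

Lemma coalg_morphism_comp {At X Y Z : Type} {d : X -> B At X}
    {e : Y -> B At Y} {f : Z -> B At Z} {h : X -> Y} {g : Y -> Z} :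
  is_coalg_morphism d e h -> is_coalg_morphism e f g ->
  is_coalg_morphism d f (g \o h).
Proof. by move=> hP gP x; rewrite /= gP hP /B_map /= Pf_map_comp. Qed.

(** The action on morphisms of the lifting of the list functor to coalgebras along [lambda']. *)
Lemma map_coalg_morphism {At X Y : Type} {d : X -> B At X} {e : Y -> B At Y}
    {h : X -> Y} :
  is_coalg_morphism d e h ->
  is_coalg_morphism (fun xs => lambda' (map d xs))
    (fun ys => lambda' (map e ys)) (map h).
Proof.
move=> hP xs; rewrite -lambda'_natural -!map_comp.
by congr lambda'; apply: eq_map => x; apply: hP.
Qed.

Lemma flatten_coalg_morphism {At : Type} (p : At -> Pf (seq At)) :
  is_coalg_morphism (fun ls => lambda' (map (fun l => (l, p_lambda p l)) ls))
    (fun l => (l, p_lambda p l)) flatten.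
Proof.
move=> ls; rewrite /lambda' /B_map /= -!map_comp p_lambda_flatten.
by congr (flatten _, _); rewrite map_id.
Qed.

Theorem theorem7p8 (S : alphabet) (P : ground_program S)
    (Omega : Type) (c : Omega -> B (ground_atom S) Omega)
    (c_final : is_final c) (ls : seq (seq (ground_atom S))) :
  semantics c_final (program_coalg P) (flatten ls) =
  ocat c_final (map (semantics c_final (program_coalg P)) ls).
Proof.
set sem := semantics _ _.
have semP := ana_morphism c_final (fun l => (l, p_lambda (program_coalg P) l)).
have lhsP := coalg_morphism_comp (flatten_coalg_morphism _) semP.
(* The second factor is [ocat] unfolded, so the composite is [ocat c_final \o map sem]. *)
have rhsP := coalg_morphism_comp (map_coalg_morphism semP)
  (ana_morphism c_final (fun ws => lambda' (map c ws))).
have := etrans (ana_unique c_final lhsP) (esym (ana_unique c_final rhsP)).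
by move/(congr1 (@^~ ls)).
Qed.
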